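(* Consider the linear benchmark serial supply chain with tiers $k=1,\dots,n$, order-up-to multipliers $\theta_k$, smoothing parameters $\lambda_k$, demand process $D=\{D_t\}$ and decision shocks $\epsilon=\{\epsilon_{k,t}\}$ described in the context. Suppose there are constants $\theta>0$ and $\lambda\in(0,1]$ with $\theta_k\ge\theta$ and $\lambda_k\in[\lambda,1]$ for every $k$. Suppose $\mathbb E[D_t]=0$ for all $t$, the $D_t$ are independent across time, and $\operatorname{Var}(D_t)\ge\sigma_D^2>0$ for all $t$. Suppose the shocks satisfy $\mathbb E[\epsilon_{k,t}]=0$, are independent across tiers and time, are independent of the demand process, and satisfy $\operatorname{Var}(\epsilon_{k,t})\ge\sigma_k^2>0$ for all $k,t$. Then the demand-driven component of the order variance satisfies, for every $k\in\{1,\dots,n\}$ and every $t$, $$V^D_{k}:=\operatorname{Var}_D\big(\mathbb E_\epsilon[q_{k,t}\mid D]\big)\ \ge\ \sigma_D^2\,\Gamma^k,\qquad \Gamma=1+2\theta\lambda+\frac{2\theta^2\lambda^2}{2-\lambda}>1.$$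
   Context: Time is indexed by $t\in\mathbb Z$; $\mathcal L$ is the lag operator, $\mathcal L x_t=x_{t-1}$. Tier $0$ is external customer demand, $q_{0,t}=D_t$. In the linear benchmark, tier $k$ ($1\le k\le n$) has real processes $q_{k,t}$ (order), $IP_{k,t}$ (inventory position), $\hat q_{k,t}$ (forecast) and decision shock $\epsilon_{k,t}$, with $$q_{k,t}=\theta_k\hat q_{k,t}+\epsilon_{k,t}-IP_{k,t},\quad IP_{k,t+1}=IP_{k,t}+q_{k,t}-q_{k-1,t},\quad \hat q_{k,t}=\lambda_k q_{k-1,t-1}+(1-\lambda_k)\hat q_{k,t-1}.$$ These yield the transfer representation $q_k=H_k(\mathcal L)q_{k-1}+G(\mathcal L)\epsilon_k$, where $$H_k(\mathcal L)=\frac{(1+\theta_k\lambda_k)\mathcal L-(\theta_k\lambda_k+1-\lambda_k)\mathcal L^2}{1-(1-\lambda_k)\mathcal L},\qquad G(\mathcal L)=1-\mathcal L.$$ Orders are understood as the stationary-regime (infinite past) solution: rational functions of $\mathcal L$ are expanded as power series $\sum_{j\ge0}a_j\mathcal L^j$, acting by $x_t\mapsto\sum_{j\ge 0}a_jx_{t-j}$, and $$q_{k,t}=\Big[\Big(\prod_{r=1}^kH_r(\mathcal L)\Big)D\Big]_t+\sum_{j=1}^k\Big[\Big(\prod_{r=j+1}^kH_r(\mathcal L)\Big)G(\mathcal L)\epsilon_j\Big]_t$$ (empty product equals the identity). All random variables have finite second moments and these series are assumed to converge in mean square. $\mathbb E_\epsilon[\,\cdot\mid D]$ denotes the conditional expectation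 given the whole demand path (averaging over the shocks), and $\operatorname{Var}_D$ is the variance over the demand path. *)

(* Defs.v *)
From HB Require Import structures.
From mathcomp Require Import all_boot all_order all_algebra.
From mathcomp Require Import all_classical all_reals all_analysis.

Set Implicit Arguments.
Unset Strict Implicit.
Unset Printing Implicit Defensive.

Import Order.TTheory GRing.Theory Num.Theory.
Import numFieldNormedType.Exports.

Local Open Scope classical_set_scope.
Local Open Scope ring_scope.

Local Notation "p %:F" := (@FracField.tofrac _ p).

Section RationalLagOperators.
Variable R : realType.

(* The indeterminate 'X stands for the lag operator L, so that rational
   functions of L are elements of the fraction field of {poly R}. *)
Definition order_transfer (theta lambda : R) : {fraction {poly R}} :=
  ((1 + theta * lambda) *: 'X - (theta * lambda + 1 - lambda) *: 'X^2)%:F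
  / (1 - (1 - lambda) *: 'X)%:F.

Definition shock_transfer : {fraction {poly R}} := (1 - 'X)%:F.

(* a is the sequence of power series coefficients of f at 0: writing f = p / q
   with q(0) != 0, the Cauchy product of q and a is p.  Such a sequence exists,
   and is unique, exactly when f has no pole at 0. *)
Definition is_expansion (f : {fraction {poly R}}) (a : nat -> R) : Prop :=
  exists p q : {poly R}, [/\ q`_0 != 0, f = p%:F / q%:F &
    forall m, \sum_(i < m.+1) q`_i * a (m - i)%N = p`_m].

Definition expansion (f : {fraction {poly R}}) : nat -> R :=
  xget (fun=> 0) [set a | is_expansion f a].

End RationalLagOperators.
Arguments shock_transfer {R}.

Section Probability.
Context {d : measure_display} {T : measurableType d} {R : realType}.
Variable P : probability T R.

Definition generated_sigma {I : Type} (J : set I) (X : I -> T -> R) :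
    set (set T) :=
  <<s \bigcup_(i in J) preimage_set_system setT (X i) measurable >>.

Definition mutually_independent {I : eqType} (J : set I) (X : I -> T -> R) :
    Prop :=
  forall (s : seq I) (B : I -> set R), uniq s ->
    (forall i, i \in s -> J i) -> (forall i, i \in s -> measurable (B i)) ->
    P (\bigcap_(i in [set i | i \in s]) (X i @^-1` B i)) =
      (\prod_(i <- s) P (X i @^-1` B i))%E.

Definition independent_sigma (F G : set (set T)) : Prop :=
  forall A B, F A -> G B -> P (A `&` B) = (P A * P B)%E.

Definition is_cond_expectation (G : set (set T)) (X Y : T -> R) : Prop :=
  [/\ forall B, measurable B -> G (Y @^-1` B),
      P.-integrable setT (EFin \o Y) &
      forall A, G A ->
        (\int[P]_(w in A) (Y w)%:E = \int[P]_(w in A) (X w)%:E)%E].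

(* An arbitrary version of E[X | G]; any two versions agree almost surely. *)
Definition cond_expectation (G : set (set T)) (X : T -> R) : T -> R :=
  xget (cst 0) [set Y | is_cond_expectation G X Y].

(* The series (f(L) x)_t = sum_j a_j x_(t - j), where sum_j a_j L^j is the
   expansion of f, converges in mean square to Z. *)
Definition ms_filter_limit (f : {fraction {poly R}}) (x : int -> T -> R)
    (t : int) (Z : T -> R) : Prop :=
  (fun N : nat => 'E_P[(fun w =>
     (\sum_(j < N) expansion f j * x (t - j%:Z) w - Z w) ^+ 2)%R]%E)
  @ \oo --> 0%E.

Record linear_benchmark (n : nat) (theta lambda : nat -> R)
    (D : int -> {RV P >-> R}) (eps q IP qhat : nat -> int -> {RV P >-> R}) :
    Prop := {
  benchmark_demand : forall t w, q 0%N t w = D t w ;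
  benchmark_order : forall k t, (1 <= k <= n)%N ->
    {ae P, forall w,
      q k t w = theta k * qhat k t w + eps k t w - IP k t w} ;
  benchmark_inventory : forall k t, (1 <= k <= n)%N ->
    {ae P, forall w, IP k (t + 1) w = IP k t w + q k t w - q k.-1 t w} ;
  benchmark_forecast : forall k t, (1 <= k <= n)%N ->
    {ae P, forall w, qhat k t w =
      lambda k * q k.-1 (t - 1) w + (1 - lambda k) * qhat k (t - 1) w} ;
  benchmark_demand_L2 : forall t, (D t : T -> R) \in Lfun P 2%:E ;
  benchmark_L2 : forall k t, (1 <= k <= n)%N ->
    [/\ (eps k t : T -> R) \in Lfun P 2%:E,
        (q k t : T -> R) \in Lfun P 2%:E,
        (IP k t : T -> R) \in Lfun P 2%:E &
        (qhat k t : T -> R) \in Lfun P 2%:E]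
}.

(* U and W j are the mean-square sums of the demand series and of the series of
   the tier-j shocks; they are determined only up to null sets, and every choice
   of versions is allowed. *)
Definition stationary_orders (n : nat) (theta lambda : nat -> R)
    (D : int -> {RV P >-> R}) (eps q : nat -> int -> {RV P >-> R}) : Prop :=
  let H r := order_transfer (theta r) (lambda r) in
  forall k t, (1 <= k <= n)%N ->
    exists (U : {RV P >-> R}) (W : nat -> {RV P >-> R}),
      [/\ ms_filter_limit (\prod_(1 <= r < k.+1) H r) (fun s => D s) t U,
          forall j, (1 <= j <= k)%N ->
            ms_filter_limit ((\prod_(j.+1 <= r < k.+1) H r) * shock_transfer)
              (fun s => eps j s) t (W j) &
          forall w, q k t w = U w + \sum_(1 <= j < k.+1) W j w].

Definition demand_sigma (D : int -> {RV P >-> R}) : set (set T) :=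
  generated_sigma setT (fun t => D t : T -> R).

Definition shock_index (n : nat) : set (nat * int) :=
  [set kt | (1 <= kt.1 <= n)%N].

Definition shock_sigma (n : nat) (eps : nat -> int -> {RV P >-> R}) :
    set (set T) :=
  generated_sigma (shock_index n) (fun kt => eps kt.1 kt.2 : T -> R).

End Probability.

Definition Gamma_factor {R : realType} (theta lambda : R) : R :=
  1 + 2 * theta * lambda + 2 * theta ^+ 2 * lambda ^+ 2 / (2 - lambda).

(* Main.v *)
Require Import Defs.
From HB Require Import structures.
From mathcomp Require Import all_boot all_order all_algebra.
From mathcomp Require Import all_classical all_reals all_analysis.
From mathcomp Require Import measurable_realfun.
From mathcomp Require Import ring lra zify.

Set Implicit Arguments.
Unset Strict Implicit.
Unset Printing Implicit Defensive.

Import Order.TTheory GRing.Theory Num.Theory.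
Import numFieldNormedType.Exports.

Local Open Scope classical_set_scope.
Local Open Scope ring_scope.

(** Pass to the spectral side: with [a = theta lambda] and [m = 1 - lambda],
    the squared modulus of [H (exp (i w))] is a decreasing function of [cos w]
    for every tier, and its mean is [1 + 2 a + 2 a^2 / (1 + m)], which is
    [Gamma_factor theta lambda].  Chebyshev's inequality for similarly ordered
    functions then bounds the energy of the product filter from below by the
    product of the energies.  This is carried out on autocorrelations of square
    summable sequences, without Fourier integrals: [autocorr y 1 / autocorr y 0]
    is the mean of [cos w] under the spectral measure of [y], and filtering by
    [H] decreases it.

    On the probabilistic side the shock series integrate to zero over demand
    events, so the conditional expectation is almost surely the mean-square sum
    of the demand series, whose variance dominates [sigmaD ^+ 2] times the
    energy of the product filter. *)

(** * Square summable sequences and their autocorrelations *)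

Section Autocorrelation.
Variable R : realType.
Implicit Types (a b u v w : nat -> R) (l : R).

Definition lag a : nat -> R := fun j => if j is i.+1 then a i else 0.

Definition sqsummable a := cvgn (series (fun j => a j ^+ 2)).

(** The [m]-th Fourier coefficient of the spectral density of [a], the squared modulus of the sum of
    [a j * exp (i j w)]. For square summable [a] the limit exists by [autocorr_cvg]. *)
Definition autocorr a m : R := limn (series (fun j => a j * a (j + m)%N)).

Lemma cvg_series_eq u v l : u =1 v -> series u @ \oo --> l ->
  series v @ \oo --> l.
Proof. by move=> /funext ->. Qed.

Lemma cvg_series_lag u l : series u @ \oo --> l -> series (lag u) @ \oo --> l.
Proof.
move=> ul; rewrite -cvg_shiftS /=.
suff -> : (fun n => series (lag u) n.+1) = series u by [].
apply/funext => n; rewrite /series/= big_nat_recl//= add0r.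
by rewrite !big_mkord.
Qed.

Lemma cvg_series_lin x y u v l l' : series u @ \oo --> l ->
  series v @ \oo --> l' ->
  series (fun j => x * u j + y * v j) @ \oo --> x * l + y * l'.
Proof.
move=> ul vl.
have -> : series (fun j => x * u j + y * v j) =
    (fun n => x * series u n + y * series v n).
  by apply/funext => n; rewrite /series/= big_split/= !mulr_sumr.
apply: cvgD; apply: cvgM => //; exact: cvg_cst.
Qed.
Arguments cvg_series_lin x y [u v l l'] _ _.

Lemma cvgn_series_addn u m : cvgn (series u) ->
  cvgn (series (fun j => u (j + m)%N)).
Proof.
move=> cu; have -> : series (fun j => u (j + m)%N) =
    (fun n => series u (n + m)%N - series u m).
  apply/funext => n; rewrite sub_series leq_addl /series/=.
  by rewrite -{2}[m]add0n big_addn addnK.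
apply: is_cvgB; last exact: is_cvg_cst.
by have /cvg_ex[l ul] := cu; apply/cvg_ex; exists l; rewrite cvg_shiftn.
Qed.
Arguments cvgn_series_addn [u] m _.

Lemma autocorr_cvg a m : sqsummable a ->
  series (fun j => a j * a (j + m)%N) @ \oo --> autocorr a m.
Proof.
move=> sa; apply: normed_cvg.
(* Domination by [|x y| <= x ^+ 2 + y ^+ 2] gives absolute convergence. *)
apply: (@series_le_cvg _ _ (fun j => 1 * a j ^+ 2 + 1 * a (j + m)%N ^+ 2)).
- by move=> n /=.
- by move=> n; rewrite addr_ge0// mul1r sqr_ge0.
- move=> n; rewrite /= !mul1r normrM -(real_normK (num_real (a n))).
  rewrite -(real_normK (num_real (a (n + m)%N))).
  have := sqr_ge0 (`|a n| - `|a (n + m)%N|).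
  by have := sqr_ge0 (`|a n| + `|a (n + m)%N|); nra.
have /cvg_ex[l1 h1] := sa; have /cvg_ex[l2 h2] := cvgn_series_addn m sa.
by apply/cvg_ex; exists (1 * l1 + 1 * l2); exact: cvg_series_lin h1 h2.
Qed.
Arguments autocorr_cvg [a] m _.

Lemma autocorr_lim a m l : series (fun j => a j * a (j + m)%N) @ \oo --> l ->
  autocorr a m = l.
Proof. by move=> al; rewrite /autocorr (cvg_lim _ al). Qed.

Lemma sqsummable_cvg a l : series (fun j => a j * a (j + 0)%N) @ \oo --> l ->
  sqsummable a.
Proof.
move=> al; apply/cvg_ex; exists l; apply: cvg_series_eq al => j.
by rewrite addn0 expr2.
Qed.

Lemma cvg_series_lag_lag a m : sqsummable a ->
  series (fun j => lag a j * lag a (j + m)%N) @ \oo --> autocorr a m.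
Proof.
move=> /(autocorr_cvg m) /cvg_series_lag; apply: cvg_series_eq.
by case=> [|j]/=; rewrite ?mul0r.
Qed.
Arguments cvg_series_lag_lag [a] m _.

(** A lag on the left factor widens the displacement by one. A lag on the right factor, treated
    next, narrows it by one. *)
Lemma cvg_series_lag_l a m : sqsummable a ->
  series (fun j => lag a j * a (j + m)%N) @ \oo --> autocorr a m.+1.
Proof.
move=> /(autocorr_cvg m.+1) /cvg_series_lag; apply: cvg_series_eq.
by case=> [|j]/=; rewrite ?mul0r// addnS addSn.
Qed.
Arguments cvg_series_lag_l [a] m _.

Lemma cvg_series_lag_r a m : sqsummable a ->
  series (fun j => a j * lag a (j + m.+1)%N) @ \oo --> autocorr a m.
Proof.
by move=> /(autocorr_cvg m); apply: cvg_series_eq => j; rewrite addnS.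
Qed.
Arguments cvg_series_lag_r [a] m _.

Lemma sqsummable_lag a : sqsummable a -> sqsummable (lag a).
Proof. by move=> /(cvg_series_lag_lag 0%N); exact: sqsummable_cvg. Qed.

Lemma autocorr_lag a m : sqsummable a -> autocorr (lag a) m = autocorr a m.
Proof. by move=> /(cvg_series_lag_lag m) /autocorr_lim. Qed.

Lemma autocorr_ge0 a : sqsummable a -> 0 <= autocorr a 0.
Proof.
move=> sa; apply: limr_ge; first exact: (cvgP _ (autocorr_cvg 0%N sa)).
apply: nearW => n; rewrite /series/= sumr_ge0// => i _.
by rewrite addn0 -expr2 sqr_ge0.
Qed.

Lemma autocorr_gt0 a i : sqsummable a -> a i != 0 -> 0 < autocorr a 0.
Proof.
move=> sa ai; rewrite (@lt_le_trans _ _ (a i ^+ 2)) ?exprn_even_gt0//.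
apply: limr_ge; first exact: (cvgP _ (autocorr_cvg 0%N sa)).
exists i.+1 => // n /= ilt; rewrite /series/= big_mkord.
rewrite (bigD1 (Ordinal ilt))//= addn0 -expr2 lerDl sumr_ge0// => j _.
by rewrite addn0 -expr2 sqr_ge0.
Qed.

(** Multiplication of the power series by [x + y L]. Numerator (after removing a factor [L]) and
    denominator of every order transfer function have this form. *)
Definition linfilter x y a : nat -> R := fun j => x * a j + y * lag a j.

(** The spectral density is multiplied by [x ^+ 2 + y ^+ 2 + 2 x y cos w], and a factor [cos w]
    averages the two neighbouring autocorrelations. At displacement 0 both neighbours equal
    [autocorr a 1]. *)
Lemma linfilter_autocorr0 x y a : sqsummable a ->
  series (fun j => linfilter x y a j * linfilter x y a (j + 0)%N) @ \oo -->
  (x ^+ 2 + y ^+ 2) * autocorr a 0 + 2 * x * y * autocorr a 1.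
Proof.
move=> sa; have h0 := autocorr_cvg 0%N sa.
have h1 := cvg_series_lag_l 0%N sa; have h2 := cvg_series_lag_lag 0%N sa.
have := cvg_series_lin (x ^+ 2) (y ^+ 2) h0 h2.
move=> /(cvg_series_lin 1 (2 * x * y))/(_ h1).
rewrite mul1r -[x ^+ 2 * _ + _]mulrDl; apply: cvg_series_eq => j.
by rewrite !addn0 /linfilter; ring.
Qed.
Arguments linfilter_autocorr0 x y [a] _.

Lemma linfilter_autocorr1 x y a : sqsummable a ->
  series (fun j => linfilter x y a j * linfilter x y a (j + 1)%N) @ \oo -->
  (x ^+ 2 + y ^+ 2) * autocorr a 1 + x * y * (autocorr a 0 + autocorr a 2).
Proof.
move=> sa; have h0 := autocorr_cvg 1%N sa.
have h1 := cvg_series_lag_l 1%N sa; have h2 := cvg_series_lag_lag 1%N sa.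
have h3 := cvg_series_lag_r 0%N sa.
have h4 := cvg_series_lin (x ^+ 2) (y ^+ 2) h0 h2.
have h5 := cvg_series_lin (x * y) (x * y) h3 h1.
have := cvg_series_lin 1 1 h4 h5.
rewrite !mul1r -mulrDr -mulrDl; apply: cvg_series_eq => j.
by rewrite /linfilter; ring.
Qed.
Arguments linfilter_autocorr1 x y [a] _.

Lemma sqsummable_linfilter x y a : sqsummable a -> sqsummable (linfilter x y a).
Proof. by move=> /(linfilter_autocorr0 x y); exact: sqsummable_cvg. Qed.
Arguments sqsummable_linfilter x y [a] _.

(* Cauchy-Schwarz for [cos w] under the spectral measure of [a], whose second
   moment is [(autocorr a 0 + autocorr a 2) / 2]. *)
Lemma autocorr_sqr_le a : sqsummable a ->
  2 * autocorr a 1 ^+ 2 <= autocorr a 0 * (autocorr a 0 + autocorr a 2).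
Proof.
move=> sa; have sla := sqsummable_lag sa.
pose s := autocorr a 1; pose n := autocorr a 0; pose r := autocorr a 2.
(* The quadratic in [t] is the energy of [(1 - 2 t L + L^2) a], that is four times the spectral
   integral of [(cos w - t) ^+ 2]. *)
suff H t : 0 <= 2 * (n + r) - 8 * t * s + 4 * t ^+ 2 * n.
  have n0 := autocorr_ge0 sa; rewrite -/n -/s -/r in n0 *.
  have [n_eq0|n_neq0] := eqVneq n 0.
    have s0 : s = 0.
      have [//|s0] := eqVneq s 0.
      (* With [n = 0] the form is affine in [t], and this value of [t] makes it equal to [-1]. *)
      have := H ((2 * r + 1) / (8 * s)); rewrite n_eq0.
      have -> : 8 * ((2 * r + 1) / (8 * s)) * s = 2 * r + 1 by field.
      by lra.
    by rewrite n_eq0 s0; lra.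
  (* The minimiser of the quadratic, namely the mean of [cos w]. *)
  have := H (s / n).
  have -> : 2 * (n + r) - 8 * (s / n) * s + 4 * (s / n) ^+ 2 * n =
    2 * (n * (n + r) - 2 * s ^+ 2) / n by field.
  by rewrite pmulr_lge0 ?invr_gt0 ?lt_neqAle 1?eq_sym ?n_neq0//; lra.
have h00 := autocorr_cvg 0%N sa.
have h11 := cvg_series_lag_lag 0%N sa.
have h22 := cvg_series_lag_lag 0%N sla.
have h01 := cvg_series_lag_l 0%N sa.
have h12 := cvg_series_lag_l 0%N sla.
have h02 : series (fun j => lag (lag a) j * a (j + 0)%N) @ \oo --> autocorr a 2.
  move: (cvg_series_lag (cvg_series_lag_l 1%N sa)); apply: cvg_series_eq.
  by case=> [|j]/=; rewrite ?mul0r// addn1 addn0.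
have h := cvg_series_lin 1 (2 : R) (cvg_series_lin 1 1 h00 h22) h02.
have h' := cvg_series_lin (- (4 * t)) (- (4 * t)) h01 h12.
have := cvg_series_lin 1 1 (cvg_series_lin 1 (4 * t ^+ 2) h h11) h'.
rewrite !mul1r !autocorr_lag// -/n -/s -/r => hh.
have -> : 2 * (n + r) - 8 * t * s + 4 * t ^+ 2 * n =
  n + n + 2 * r + 4 * t ^+ 2 * n + (- (4 * t) * s + - (4 * t) * s) by ring.
rewrite -(cvg_lim _ hh)//; apply: limr_ge; first exact: (cvgP _ hh).
apply: nearW => k; rewrite /series/= sumr_ge0// => j _.
rewrite !addn0.
rewrite [leRHS](_ : _ = (a j + lag (lag a) j - 2 * t * lag a j) ^+ 2).
  exact: sqr_ge0.
by ring.
Qed.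

(** Division of the power series by [1 - m L], as [arfilterK] confirms. *)
Fixpoint arfilter m a j : R :=
  if j is i.+1 then a i.+1 + m * arfilter m a i else a 0%N.

Lemma arfilterK m a : linfilter 1 (- m) (arfilter m a) = a.
Proof. by apply/funext => -[|j]; rewrite /linfilter/=; ring. Qed.

Lemma sqsummable_arfilter m a : 0 <= m < 1 -> sqsummable a ->
  sqsummable (arfilter m a).
Proof.
move=> /andP[m0 m1] sa; pose y := arfilter m a.
(* Division by [1 - m L] has norm at most [1 / (1 - m)]. The extra term in [y n ^+ 2] closes the
   induction: the slack of each step is exactly [m * (a n.+1 - (1 - m) * y n) ^+ 2]. *)
have bnd n : (1 - m) ^+ 2 * series (fun j => y j ^+ 2) n.+1
    + m * (1 - m) * y n ^+ 2 <= series (fun j => a j ^+ 2) n.+1.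
  elim: n => [|n IH].
    rewrite /series/= !big_nat1 /y/=.
    by have := mulr_ge0 m0 (sqr_ge0 (a 0%N)); nra.
  rewrite !(seriesSr _ n.+1) (le_trans _ (lerD IH (lexx _)))// /y/= -/y.
  by have := mulr_ge0 m0 (sqr_ge0 (a n.+1 - (1 - m) * y n)); nra.
apply: nondecreasing_is_cvgn.
  by apply: nondecreasing_series => i _ _; exact: sqr_ge0.
exists (limn (series (fun j => a j ^+ 2)) / (1 - m) ^+ 2) => _ [n _ <-].
have m20 : 0 < (1 - m) ^+ 2 by rewrite exprn_gt0// subr_gt0.
rewrite ler_pdivlMr// mulrC.
have nd u : {homo series (fun j => u j ^+ 2 : R) : p q / (p <= q)%N >-> p <= q}.
  apply: (@nondecreasing_series R (fun j => u j ^+ 2) xpredT 0%N) => i _ _.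
  exact: sqr_ge0.
apply: (@le_trans _ _ (series (fun j => a j ^+ 2) n.+1)); last first.
  exact: nondecreasing_cvgn_le.
apply: le_trans (bnd n); rewrite ler_wpDr//.
  by apply: mulr_ge0 (sqr_ge0 _); rewrite mulr_ge0// subr_ge0 ltW.
by apply: ler_wpM2l; [exact: ltW|exact: nd].
Qed.

Definition unit_impulse : nat -> R := fun j => (j == 0)%N%:R.

Lemma unit_impulse_autocorr m :
  series (fun j => unit_impulse j * unit_impulse (j + m)%N) @ \oo -->
  ((m == 0)%N%:R : R).
Proof.
rewrite -cvg_shiftS.
rewrite (_ : (fun n => _) = cst (m == 0)%N%:R); first exact: cvg_cst.
apply/funext => n /=; rewrite /series/= big_nat_recl// big1 ?addr0.
  by rewrite /unit_impulse mul1r add0n.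
by move=> i _; rewrite /unit_impulse mul0r.
Qed.
Arguments unit_impulse_autocorr : clear implicits.

Lemma sqsummable_unit_impulse : sqsummable unit_impulse.
Proof. exact: sqsummable_cvg (unit_impulse_autocorr 0%N). Qed.
Arguments sqsummable_unit_impulse : clear implicits.

(** The difference of the two sides is half the energy of [(1 - L) a]. *)
Lemma autocorr_le0 a : sqsummable a -> autocorr a 1 <= autocorr a 0.
Proof.
move=> sa; have := autocorr_ge0 (sqsummable_linfilter 1 (-1) sa).
by rewrite (autocorr_lim (linfilter_autocorr0 1 (-1) sa)); nra.
Qed.

(** The sequence is geometric of ratio [m], so a unit shift multiplies it by [m]. *)
Lemma arfilter_impulse_autocorr m : 0 <= m < 1 ->
  autocorr (arfilter m unit_impulse) 1 =
  m * autocorr (arfilter m unit_impulse) 0.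
Proof.
move=> m01; apply: autocorr_lim.
have h := autocorr_cvg 0%N (sqsummable_arfilter m01 sqsummable_unit_impulse).
have := cvg_series_lin m 0 h h; rewrite mul0r addr0; apply: cvg_series_eq => j.
by rewrite addn1 addn0/= /unit_impulse/=; ring.
Qed.

(* The squared modulus of [((1 + a) - (a + m) z) / (1 - m z)] at [z = exp (i w)]
   is a decreasing function of [cos w], so that reweighting a spectral measure
   by it lowers the mean of [cos w]. *)
Lemma autocorr_ratio_decr (a m : R) (y : nat -> R) :
  0 <= a -> 0 <= m -> sqsummable y ->
  autocorr (linfilter (1 + a) (- (a + m)) y) 1 *
    autocorr (linfilter 1 (- m) y) 0 <=
  autocorr (linfilter 1 (- m) y) 1 *
    autocorr (linfilter (1 + a) (- (a + m)) y) 0.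
Proof.
move=> a0 m0 sy.
rewrite (autocorr_lim (linfilter_autocorr0 _ _ sy)).
rewrite (autocorr_lim (linfilter_autocorr0 _ _ sy)).
rewrite (autocorr_lim (linfilter_autocorr1 _ _ sy)).
rewrite (autocorr_lim (linfilter_autocorr1 _ _ sy)).
have := autocorr_sqr_le sy.
move: (autocorr y 0) (autocorr y 1) (autocorr y 2) => n s r h.
(* The difference is, up to a constant, the determinant of the two squared moduli, which are affine
   in [cos w], times the Cauchy-Schwarz gap of [autocorr_sqr_le]. *)
rewrite -subr_ge0 [X in 0 <= X](_ : _ =
  (1 - m) ^+ 2 * (a + a ^+ 2 + a * m) *
  (n * (n + r) - 2 * s ^+ 2)); last by ring.
apply: mulr_ge0; last by rewrite subr_ge0.
by rewrite mulr_ge0 ?sqr_ge0// !addr_ge0 ?sqr_ge0// mulr_ge0.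
Qed.

(** Both sides are linear in [autocorr y 0] and [autocorr y 1], and they agree when
    [autocorr y 1 = m * autocorr y 0], as for the geometric sequence of ratio [m]. A lower
    correlation only raises the gain. *)
Lemma autocorr_gain (a m : R) (y : nat -> R) :
  0 <= a -> 0 <= m < 1 -> sqsummable y ->
  autocorr y 1 <= m * autocorr y 0 ->
  (1 + 2 * a + 2 * a ^+ 2 / (1 + m)) * autocorr (linfilter 1 (- m) y) 0 <=
  autocorr (linfilter (1 + a) (- (a + m)) y) 0.
Proof.
move=> a0 /andP[m0 m1] sy sn.
rewrite !(autocorr_lim (linfilter_autocorr0 _ _ sy)).
move: (autocorr y 0) (autocorr y 1) sn => n s sn.
have m1' : 0 < 1 + m by lra.
rewrite -subr_ge0 [X in 0 <= X](_ : _ =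
  2 * (1 - m) * (a + a ^+ 2 / (1 + m)) * (m * n - s)); last first.
  by field; rewrite gt_eqF.
apply: mulr_ge0; last by rewrite subr_ge0.
rewrite mulr_ge0 ?addr_ge0 ?divr_ge0 ?sqr_ge0 ?(ltW m1')//.
by rewrite mulr_ge0// subr_ge0 ltW.
Qed.

(** The squared moduli differ by [2 (a + a^2 + a m) (1 - cos w)], which is nonnegative at every
    frequency. This keeps energies positive along the chain. *)
Lemma autocorr_le_linfilter (a m : R) (y : nat -> R) :
  0 <= a -> 0 <= m -> sqsummable y ->
  autocorr (linfilter 1 (- m) y) 0 <=
  autocorr (linfilter (1 + a) (- (a + m)) y) 0.
Proof.
move=> a0 m0 sy; have := autocorr_le0 sy.
rewrite !(autocorr_lim (linfilter_autocorr0 _ _ sy)).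
move: (autocorr y 0) (autocorr y 1) => n s sn.
rewrite -subr_ge0 [X in 0 <= X](_ : _ =
  2 * (a + a ^+ 2 + a * m) * (n - s)); last by ring.
apply: mulr_ge0; last by rewrite subr_ge0.
by rewrite mulr_ge0// !addr_ge0 ?sqr_ge0// mulr_ge0.
Qed.
End Autocorrelation.
Arguments sqsummable_linfilter {R} x y [a] _.

(** * Power series expansions of rational functions *)

Local Notation "p %:F" := (@FracField.tofrac _ p).

Section Expansion.
Variable R : realType.
Implicit Types (p q r : {poly R}) (a b : nat -> R) (f : {fraction {poly R}}).

Definition series_mul q a : nat -> R :=
  fun m => \sum_(i < m.+1) q`_i * a (m - i)%N.

(** Coefficients below [N] see only a polynomial truncation of [a], so associativity of the Cauchy
    product is inherited from [{poly R}]. *)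
Lemma series_mul_poly q a N m : (m < N)%N ->
  series_mul q a m = (q * \poly_(i < N) a i)`_m.
Proof.
move=> mN; rewrite coefM; apply: eq_bigr => i _.
by rewrite coef_poly (leq_ltn_trans (leq_subr _ _)).
Qed.

Lemma series_mulA q r a :
  series_mul (q * r) a = series_mul q (series_mul r a).
Proof.
apply/funext => m; rewrite (series_mul_poly _ _ (ltnSn m)) -mulrA coefM.
by apply: eq_bigr => i _; rewrite -series_mul_poly// ltnS leq_subr.
Qed.

Lemma series_mul_coef q p :
  series_mul q (fun i => p`_i) = (fun i => (q * p)`_i).
Proof. by apply/funext => m; rewrite coefM. Qed.

(** As [q] has a nonzero constant term, each coefficient of the factor is determined by the product
    and the earlier coefficients. *)
Lemma series_mulI q a b : q`_0 != 0 -> series_mul q a = series_mul q b -> a = b.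
Proof.
move=> q0 qab; apply/funext; elim/ltn_ind => m IH.
have := congr1 (@^~ m) qab; rewrite /series_mul !big_ord_recl !subn0.
under eq_bigr => i _ do rewrite IH ?ltn_subrL ?(leq_ltn_trans _ (ltn_ord i))//.
by move=> /addIr /(mulfI q0).
Qed.

Lemma linfilterE x y a : linfilter x y a = series_mul (x%:P + y *: 'X) a.
Proof.
apply/funext => -[|m]; rewrite /linfilter /series_mul.
  by rewrite big_ord1 subn0 !coefE/= !mulr0 !addr0.
rewrite !big_ord_recl big1 ?addr0.
  by rewrite subn0 /= subSS subn0 !coefE/= mulr0 mulr1 addr0 add0r.
by move=> i _; rewrite !coefE/= mulr0 add0r mul0r.
Qed.

Lemma is_expansionP f a :
  is_expansion f a <-> exists p q, [/\ q`_0 != 0, f = p%:F / q%:F &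
    series_mul q a = fun i => p`_i].
Proof.
split=> -[p [q [q0 fE h]]]; exists p, q; split=> //; first exact/funext.
by move=> m; exact: (congr1 (@^~ m) h).
Qed.

Lemma tofrac_neq0 q : q`_0 != 0 -> q%:F != 0.
Proof. by rewrite tofrac_eq0; apply: contraNneq => ->; rewrite coef0. Qed.

(** Multiplying by both denominators turns the claim into the cross-multiplied identity between the
    two fractions. *)
Lemma is_expansion_unique f a b :
  is_expansion f a -> is_expansion f b -> a = b.
Proof.
move=> /is_expansionP[p [q [q0 -> pE]]] /is_expansionP[p' [q' [q'0 pq p'E]]].
have qq0 : (q * q')`_0 != 0 by rewrite coefM big_ord1 subn0 mulf_neq0.
apply: (series_mulI qq0).
rewrite {1}mulrC !series_mulA pE p'E !series_mul_coef.
move/eqP: pq; rewrite eqr_div ?tofrac_neq0// -!rmorphM/= tofrac_eq => /eqP.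
by rewrite mulrC [q * p']mulrC => ->.
Qed.

Lemma expansionE f a : is_expansion f a -> expansion f = a.
Proof.
move=> fa; apply: (@is_expansion_unique f) => //.
by apply: (@xgetPex _ (fun=> 0) [set a | is_expansion f a]); exists a.
Qed.

Lemma is_expansion1 : is_expansion (1 : {fraction {poly R}}) (@unit_impulse R).
Proof.
exists 1, 1; split; first by rewrite coef1 oner_eq0.
  by rewrite rmorph1 divr1.
move=> m; rewrite big_ord_recl big1 ?addr0 ?coef1 ?mul1r ?subn0//.
by move=> i _; rewrite coef1 mul0r.
Qed.

Lemma is_expansion_linfilter f a x y : is_expansion f a ->
  is_expansion ((x%:P + y *: 'X)%:F * f) (linfilter x y a).
Proof.
move=> /is_expansionP[p [q [q0 -> pE]]]; apply/is_expansionP.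
exists ((x%:P + y *: 'X) * p), q; split=> //; first by rewrite rmorphM mulrA.
by rewrite linfilterE -series_mulA mulrC series_mulA pE series_mul_coef.
Qed.

Lemma is_expansion_arfilter f a m : is_expansion f a ->
  is_expansion (f / (1 - m *: 'X)%:F) (arfilter m a).
Proof.
move=> /is_expansionP[p [q [q0 -> pE]]]; apply/is_expansionP.
have m0 : (1 - m *: 'X : {poly R})`_0 != 0.
  by rewrite !coefE/= mulr0 subr0 oner_eq0.
exists p, (q * (1 - m *: 'X)); split.
- by rewrite coefM big_ord1 subn0 mulf_neq0.
- by rewrite rmorphM/= invfM mulrA.
- rewrite series_mulA -pE; congr series_mul.
  by rewrite -{2}(arfilterK m a) linfilterE scaleNr.
Qed.
End Expansion.

(** * Correlation and energy of the product of order transfer functions *)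

Section TransferProduct.
Variable R : realType.
Variables (theta lambda : nat -> R) (n : nat).
Hypothesis theta_ge0 : forall k, (1 <= k <= n)%N -> 0 <= theta k.
Hypothesis lambda01 : forall k, (1 <= k <= n)%N -> 0 < lambda k <= 1.
Let H r := order_transfer (theta r) (lambda r).

(** The transfer function is applied in three stages: division by its denominator, multiplication by
    the linear part of its numerator, then one lag, which preserves autocorrelations. *)
Lemma is_expansion_order_transfer (t l : R) f a : is_expansion f a ->
  is_expansion (order_transfer t l * f)
    (lag (linfilter (1 + t * l) (- (t * l + (1 - l))) (arfilter (1 - l) a))).
Proof.
move=> fa.
have lagE u : lag u = linfilter 0 1 u :> (nat -> R).
  by apply/funext => j; rewrite /linfilter mul0r mul1r add0r.
rewrite lagE.
have := is_expansion_linfilter 0 1 (is_expansion_linfilter (1 + t * l)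
  (- (t * l + (1 - l))) (is_expansion_arfilter (1 - l) fa)).
congr is_expansion; rewrite /order_transfer !mulrA -rmorphM/=.
rewrite mulrAC; congr (_%:F / _ * _).
rewrite polyC0 add0r scale1r mulrDr -scalerAr -expr2 scaleNr addrA.
by rewrite ['X * _]mulrC mul_polyC.
Qed.

(** The parameter [m] is free because it will be the smoothing pole of the next tier, unrelated to
    the earlier ones. The ratio of autocorrelations starts at exactly [m], for the geometric
    sequence, and each tier lowers it. *)
Lemma transfer_product_correlation k m : (k <= n)%N -> 0 <= m < 1 ->
  exists w, [/\ is_expansion ((\prod_(1 <= r < k.+1) H r) / (1 - m *: 'X)%:F) w,
    sqsummable w, 0 < autocorr w 0 & autocorr w 1 <= m * autocorr w 0].
Proof.
move=> + m01; elim: k => [_|k IH kn].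
  have sw := sqsummable_arfilter m01 (@sqsummable_unit_impulse R).
  exists (arfilter m (@unit_impulse R)); split => //.
  - by rewrite big_nil; exact/is_expansion_arfilter/is_expansion1.
  - by apply: (autocorr_gt0 (i := 0%N)) => //=; rewrite oner_eq0.
  - by rewrite arfilter_impulse_autocorr.
have [w [ew sw w0 w1]] := IH (ltnW kn).
have kn1 : (1 <= k.+1 <= n)%N by [].
have tk := theta_ge0 kn1; have /andP[l0 l1] := lambda01 kn1.
have mu01 : 0 <= 1 - lambda k.+1 < 1 by apply/andP; split; lra.
have mu0 : 0 <= 1 - lambda k.+1 by lra.
have a0 : 0 <= theta k.+1 * lambda k.+1 by rewrite mulr_ge0// ltW.
have sy := sqsummable_arfilter mu01 sw.
have sv := sqsummable_linfilter (1 + theta k.+1 * lambda k.+1)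
  (- (theta k.+1 * lambda k.+1 + (1 - lambda k.+1))) sy.
eexists; split.
- rewrite big_nat_recr//= mulrAC mulrC; exact: is_expansion_order_transfer ew.
- exact: sqsummable_lag.
- rewrite autocorr_lag//; apply: lt_le_trans (autocorr_le_linfilter a0 mu0 sy).
  by rewrite arfilterK.
(* Ratios are compared after multiplication by the positive energy of the previous stage. *)
- rewrite !autocorr_lag// -(ler_pM2r w0).
  have := autocorr_ratio_decr a0 mu0 sy.
  rewrite /= arfilterK => /le_trans; apply.
  rewrite mulrAC ler_wpM2r// autocorr_ge0//.
Qed.

Lemma transfer_product_energy k g : (k <= n)%N ->
  0 <= g ->
  (forall r, (1 <= r <= n)%N -> g <= Gamma_factor (theta r) (lambda r)) ->
  exists a, [/\ is_expansion (\prod_(1 <= r < k.+1) H r) a, sqsummable a &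
    g ^+ k <= autocorr a 0].
Proof.
move=> + g0 gG; elim: k => [_|k IH kn].
  exists (@unit_impulse R); split; rewrite ?big_nil.
  - exact: is_expansion1.
  - exact: (@sqsummable_unit_impulse R).
  - by rewrite (autocorr_lim (@unit_impulse_autocorr R 0%N)).
have [a [ea sa ga]] := IH (ltnW kn).
have kn1 : (1 <= k.+1 <= n)%N by [].
have tk := theta_ge0 kn1; have /andP[l0 l1] := lambda01 kn1.
have mu01 : 0 <= 1 - lambda k.+1 < 1 by apply/andP; split; lra.
have mu0 : 0 <= 1 - lambda k.+1 by lra.
have a0 : 0 <= theta k.+1 * lambda k.+1 by rewrite mulr_ge0// ltW.
have sy := sqsummable_arfilter mu01 sa.
have sv := sqsummable_linfilter (1 + theta k.+1 * lambda k.+1)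
  (- (theta k.+1 * lambda k.+1 + (1 - lambda k.+1))) sy.
eexists; split.
- by rewrite big_nat_recr//= mulrC; exact: is_expansion_order_transfer ea.
- exact: sqsummable_lag.
rewrite autocorr_lag//.
(* The correlation bound at the pole of the new tier; uniqueness of expansions identifies [w] with
   the filtered [a], so that [autocorr_gain] applies. *)
have [w [ew _ _ w1]] := transfer_product_correlation (ltnW kn) mu01.
have ? := is_expansion_unique ew (is_expansion_arfilter (1 - lambda k.+1) ea).
subst w; have := autocorr_gain a0 mu01 sy w1.
rewrite arfilterK; apply: le_trans.
rewrite exprS ler_pM ?exprn_ge0//; apply: le_trans (gG _ kn1) _.
(* The gain with [a = theta * lambda] and [1 + m = 2 - lambda] is the tier's own factor. *)
rewrite /Gamma_factor le_eqVlt; apply/orP; left; apply/eqP.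
by field; rewrite gt_eqF//; lra.
Qed.
End TransferProduct.

(** * Monotonicity and size of the growth factor *)

Lemma Gamma_factor_homo (R : realType) (t l t' l' : R) : 0 < t -> 0 < l ->
  t <= t' -> l <= l' <= 1 -> Gamma_factor t l <= Gamma_factor t' l'.
Proof.
move=> t0 l0 tt /andP[ll l1]; rewrite /Gamma_factor.
have tl : t * l <= t' * l' by rewrite ler_pM ?(ltW t0) ?(ltW l0).
have tl0 : 0 <= t * l by rewrite mulr_ge0// ltW.
(* Written through the product [x * y], the factor increases with that product and with [y]. *)
have E x y : 1 + 2 * x * y + 2 * x ^+ 2 * y ^+ 2 / (2 - y) =
    1 + 2 * (x * y) + 2 * ((x * y) ^+ 2 / (2 - y)) :> R by ring.
have tl2 : (t * l) ^+ 2 <= (t' * l') ^+ 2.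
  by rewrite ler_sqr ?nnegrE// (le_trans tl0).
have vl : (2 - l)^-1 <= (2 - l')^-1 by rewrite lef_pV2 ?posrE; lra.
have v0 : 0 <= (2 - l)^-1 by rewrite invr_ge0; lra.
by rewrite !E !lerD// ler_wpM2l// ler_pM// sqr_ge0.
Qed.

Lemma Gamma_factor_gt1 (R : realType) (t l : R) : 0 < t -> 0 < l <= 1 ->
  1 < Gamma_factor t l.
Proof.
move=> t0 /andP[l0 l1]; rewrite /Gamma_factor -addrA ltrDl.
rewrite ltr_wpDr ?divr_ge0 ?mulr_ge0 ?mulr_gt0 ?sqr_ge0 //.
all: by rewrite ?(ltW t0) ?(ltW l0)//; lra.
Qed.

(** * Independence, mean-square limits and conditional expectations *)

Section Independence.
Context {d : measure_display} {T : measurableType d} {R : realType}.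
Variable P : probability T R.

(** Independence makes the joint law agree with the product of the laws on rectangles, hence
    everywhere; Fubini then separates the integral. Square integrability makes the product
    integrable. *)
Lemma expectation_indepM (X Y : {RV P >-> R}) :
  (X : T -> R) \in Lfun P 2%:E -> (Y : T -> R) \in Lfun P 2%:E ->
  (forall A B, measurable A -> measurable B ->
    P (X @^-1` A `&` Y @^-1` B) = (P (X @^-1` A) * P (Y @^-1` B))%E) ->
  'E_P[(X : T -> R) * Y]%E = ('E_P[X] * 'E_P[Y])%E.
Proof.
move=> X2 Y2 indXY.
have Pfin : P setT \is a fin_num := fin_num_measure P _ measurableT.
have X1 := Lfun_subset12 Pfin X2; have Y1 := Lfun_subset12 Pfin Y2.
have XY1 := Lfun2_mul_Lfun1 X2 Y2.
pose Z : T -> R * R := fun w => (X w, Y w).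
have mZ : measurable_fun [set: T] Z.
  by apply: measurable_fun_pair; exact: measurable_funP.
pose HZ := isMeasurableFun.Build _ _ _ _ Z mZ.
pose ZZ : {mfun T >-> (R * R)%type} := HB.pack Z HZ.
pose mX : probability _ R := distribution P X.
pose mY : probability _ R := distribution P Y.
pose mZZ : probability _ R := distribution P ZZ.
have mE A : measurable A -> (mX \x mY)%E A = mZZ A.
  by apply: product_measure_unique => B C mB mC; exact: indXY.
pose f : R * R -> \bar R := fun z => (z.1 * z.2)%:E.
have mf : measurable_fun [set: R * R] f.
  by apply/measurable_EFinP; exact: measurable_funM.
have fZ : mZZ.-integrable setT f.
  by apply: integrable_pushforward => //=; exact/Lfun1_integrable.
have fXY : (mX \x mY)%E.-integrable setT f.
  apply/integrableP; split=> //; move/integrableP : fZ => [_].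
  apply: le_lt_trans.
  by rewrite le_eqVlt (eq_measure_integral mZZ) ?eqxx// => A mA _; exact: mE.
have -> : 'E_P[(X : T -> R) * Y]%E = (\int[mZZ]_z f z)%E.
  rewrite unlock /mZZ integral_distribution//; exact/Lfun1_integrable.
rewrite (eq_measure_integral (mX \x mY)%E); last first.
  by move=> A mA _; symmetry; exact: mE.
rewrite -integral12_prod_meas1//= /fubini_F /f/=.
have EX : (\int[mX]_x x%:E = 'E_P[X])%E.
  by rewrite unlock /mX integral_distribution//; exact/Lfun1_integrable.
have EY : (\int[mY]_x x%:E = 'E_P[Y])%E.
  by rewrite unlock /mY integral_distribution//; exact/Lfun1_integrable.
have iY : mY.-integrable setT (fun y => y%:E).
  apply: integrable_pushforward => //=; first exact/measurable_EFinP.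
  exact/Lfun1_integrable.
have iX : mX.-integrable setT (fun y => y%:E).
  apply: integrable_pushforward => //=; first exact/measurable_EFinP.
  exact/Lfun1_integrable.
under eq_integral => x _.
  under eq_integral => y _ do rewrite EFinM.
  rewrite integralZl// EY.
  over.
rewrite /= -EX -(fineK (expectation_fin_num Y1)).
by rewrite integralZr.
Qed.

Lemma mutually_independent_pair {I : eqType} (J : set I) (X : I -> T -> R) i j
    (A B : set R) :
  mutually_independent P J X -> J i -> J j -> i != j ->
  measurable A -> measurable B ->
  P (X i @^-1` A `&` X j @^-1` B) = (P (X i @^-1` A) * P (X j @^-1` B))%E.
Proof.
move=> indX Ji Jj ij mA mB.
have := indX [:: i; j] (fun k => if k == i then A else B).
rewrite big_cons big_seq1 eqxx eq_sym (negPf ij) /=.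
move=> <-; first last.
- by move=> k _; case: ifP.
- by move=> k; rewrite !inE => /orP[]/eqP->.
- by rewrite inE ij.
congr (P _); apply/seteqP; split => w /=.
  by move=> [Aw Bw] k; rewrite /= !inE; case: eqVneq => [->//|_ /= /eqP->].
move=> h; split; first by have := h i; rewrite /= eqxx !inE eqxx/=; apply.
by have := h j; rewrite /= eq_sym (negPf ij) !inE eqxx orbT; apply.
Qed.

Lemma covariance_indep (X Y : {RV P >-> R}) :
  (X : T -> R) \in Lfun P 2%:E -> (Y : T -> R) \in Lfun P 2%:E ->
  (forall A B, measurable A -> measurable B ->
    P (X @^-1` A `&` Y @^-1` B) = (P (X @^-1` A) * P (Y @^-1` B))%E) ->
  covariance P X Y = 0%E.
Proof.
move=> X2 Y2 indXY.
have Pfin : P setT \is a fin_num := fin_num_measure P _ measurableT.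
have X1 := Lfun_subset12 Pfin X2; have Y1 := Lfun_subset12 Pfin Y2.
rewrite covarianceE ?Lfun2_mul_Lfun1// expectation_indepM// subee//.
by rewrite fin_numM// expectation_fin_num.
Qed.

Lemma Lfun2_lincomb (N : nat) (c : nat -> R) (X : nat -> T -> R) :
  (forall i, X i \in Lfun P 2%:E) ->
  (fun w => \sum_(i < N) c i * X i w) \in Lfun P 2%:E.
Proof.
move=> X2; rewrite [X in X \in _](_ : _ = \sum_(i < N) (c i \o* X i)%R).
  apply: rpred_sum; first by rewrite lee1n.
  by move=> p1 i _; rewrite Lfun_scale// ler1n.
by apply/funext => w; rewrite fct_sumE; apply: eq_bigr => i _; rewrite mulrC.
Qed.

Lemma variance_sum_uncorrelated (N : nat) (c : nat -> R) (X : nat -> T -> R) :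
  (forall i, X i \in Lfun P 2%:E) ->
  (forall i j, i != j -> covariance P (X i) (X j) = 0%E) ->
  'V_P[fun w => \sum_(i < N) c i * X i w] =
    (\sum_(i < N) (c i ^+ 2)%:E * 'V_P[X i])%E.
Proof.
move=> X2 X0.
have Pfin : P setT \is a fin_num := fin_num_measure P _ measurableT.
have X1 i := Lfun_subset12 Pfin (X2 i).
have XX1 i j := Lfun2_mul_Lfun1 (X2 i) (X2 j).
have cX2 i : (c i \o* X i)%R \in Lfun P 2%:E by rewrite Lfun_scale// ler1n.
have S2 n := Lfun2_lincomb n c X2.
have covS n j : (n <= j)%N ->
    covariance P (fun w => \sum_(i < n) c i * X i w) (X j) = 0%E.
  elim: n => [_|n IH nj].
    rewrite [X in covariance P X _](_ : _ = cst 0) ?covariance_cst_l//.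
    by apply/funext => w; rewrite big_ord0.
  rewrite [X in covariance P X _](_ : _ =
      (fun w => \sum_(i < n) c i * X i w) \+ (c n \o* X n)%R); last first.
    by apply/funext => w; rewrite big_ord_recr/= [X in _ + X]mulrC.
  rewrite (covarianceDl (S2 n) (cX2 n) (X2 j)) IH; last exact: ltnW.
  by rewrite (covarianceZl _ (X1 n) (X1 j) (XX1 n j)) X0 ?ltn_eqF// mule0 adde0.
elim: N => [|n IH].
  rewrite big_ord0 [X in variance P X](_ : _ = cst 0) ?variance_cst//.
  by apply/funext => w; rewrite big_ord0.
rewrite [X in variance P X](_ : _ =
    (fun w => \sum_(i < n) c i * X i w) \+ (c n \o* X n)%R); last first.
  by apply/funext => w; rewrite big_ord_recr/= [X in _ + X]mulrC.
rewrite (varianceD (S2 n) (cX2 n)) IH big_ord_recr/= (varianceZ _ (X2 n)).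
rewrite (covarianceZr _ (Lfun_subset12 Pfin (S2 n)) (X1 n)).
  by rewrite covS// !mule0 adde0.
exact: Lfun2_mul_Lfun1.
Qed.
End Independence.

(** * Limits in mean square *)

Section MeanSquare.
Context {d : measure_display} {T : measurableType d} {R : realType}.
Variable P : probability T R.

Lemma Lfun2_expectation_sqr (Z : T -> R) : measurable_fun setT Z ->
  ('E_P[fun w => (Z w ^+ 2)%R] < +oo)%E -> Z \in Lfun P 2%:E.
Proof.
move=> mZ; rewrite unlock => Zoo; rewrite inE/=; apply/andP; split.
  by rewrite inE.
rewrite inE/= /finite_norm unlock poweR_lty//.
rewrite [X in (X < _)%E](_ : _ = \int[P]_w (Z w ^+ 2)%:E)%E//.
apply: eq_integral => w _ /=.
by rewrite powR_mulrn// -normrX ger0_norm// sqr_ge0.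
Qed.

Lemma expectation_sqr_fin (Z : T -> R) : Z \in Lfun P 2%:E ->
  'E_P[fun w => (Z w ^+ 2)%R]%E \is a fin_num.
Proof.
move=> Z2; apply: expectation_fin_num; apply/Lfun1_integrable.
exact: Lfun2_integrable_sqr.
Qed.

Lemma variance_le_sqr (Z : T -> R) : Z \in Lfun P 2%:E ->
  ('V_P[Z] <= 'E_P[fun w => (Z w ^+ 2)%R])%E.
Proof.
move=> Z2; have Pfin : P setT \is a fin_num := fin_num_measure P _ measurableT.
rewrite (varianceE Z2) -(fineK (expectation_fin_num (Lfun_subset12 Pfin Z2))).
by rewrite leeBlDr// leeDl// lee_fin sqr_ge0.
Qed.

Variables (S : nat -> T -> R) (Z : T -> R).
Hypothesis mS : forall N, measurable_fun setT (S N).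
Hypothesis mZ : measurable_fun setT Z.
Hypothesis SZ :
  (fun N => 'E_P[fun w => ((S N w - Z w) ^+ 2)%R])%E @ \oo --> 0%E.

Lemma ms_limit_lt (e : R) : 0 < e ->
  exists N, ('E_P[fun w => ((S N w - Z w) ^+ 2)%R] < e%:E)%E.
Proof.
move=> e0; have /fine_cvgP[[N1 _ h1] h2] := SZ.
have [N2 _ {}h2] := cvgr_lt _ h2 _ e0.
exists (maxn N1 N2); rewrite -[ltLHS]fineK; last by apply: h1; exact: leq_maxl.
by rewrite lte_fin; apply: h2; exact: leq_maxr.
Qed.

Let mSZ N : measurable_fun setT (fun w => S N w - Z w).
Proof. exact: measurable_funB. Qed.

(** A single index at which the error has a finite second moment suffices. *)
Lemma ms_limit_Lfun2 : (forall N, S N \in Lfun P 2%:E) -> Z \in Lfun P 2%:E.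
Proof.
move=> S2; have [N hN] := ms_limit_lt ltr01.
have D2 : (fun w => S N w - Z w) \in Lfun P 2%:E.
  by apply: Lfun2_expectation_sqr => //; rewrite (lt_trans hN)// ltry.
rewrite (_ : Z = S N - (fun w => S N w - Z w)).
  by rewrite rpredB ?lee1n.
by apply/funext => w; rewrite !fctE opprB addrC subrK.
Qed.

Lemma ms_limit_variance (v : nat -> R) (l : R) :
  (forall N, S N \in Lfun P 2%:E) ->
  (forall N, ((v N)%:E <= 'V_P[S N])%E) -> v @ \oo --> l ->
  (l%:E <= 'V_P[Z])%E.
Proof.
move=> S2 vS vl; have Z2 := ms_limit_Lfun2 S2.
have D2 N : (S N - Z) \in Lfun P 2%:E by rewrite rpredB ?lee1n.
pose e N := fine 'E_P[fun w => ((S N w - Z w) ^+ 2)%R]%E.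
have eE N : (e N)%:E = 'E_P[fun w => ((S N w - Z w) ^+ 2)%R]%E.
  exact: fineK (expectation_sqr_fin (D2 N)).
have e0 : e @ \oo --> 0 by have /fine_cvgP[] := SZ.
pose z := fine 'V_P[Z].
have zE : z%:E = 'V_P[Z] by rewrite fineK// variance_fin_num.
have z0 : 0 <= z by rewrite -lee_fin zE variance_ge0.
(* The variance of [Z + (S N - Z)] is expanded, with Cauchy-Schwarz for the covariance and the
   second moment [e N] bounding the variance of the error. *)
have bnd N : v N <= z + e N + 2 * (Num.sqrt z * Num.sqrt (e N)).
  rewrite -lee_fin (le_trans (vS N))//.
  have -> : S N = Z \+ (S N - Z).
    by apply/funext => w; change (S N w = Z w + (S N w - Z w)); ring.
  rewrite (varianceD Z2 (D2 N)) (EFinD (z + e N)) (EFinD z) zE eE.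
  have Vle : ('V_P[(S N - Z)%R] <= (e N)%:E)%E by rewrite eE variance_le_sqr.
  apply: leeD; first by rewrite leeD2l// -eE.
  rewrite EFinM lee_pmul2l//. apply: le_trans (covariance_le Z2 (D2 N)) _.
  rewrite -zE EFinM lee_pmul ?sqrte_ge0//.
  have vfin := variance_fin_num (D2 N).
  rewrite -(fineK vfin) /= lee_fin ler_wsqrtr// -lee_fin fineK//.
rewrite -zE lee_fin.
have h : (fun N => z + e N + 2 * (Num.sqrt z * Num.sqrt (e N))) @ \oo -->
    z + 0 + 2 * (Num.sqrt z * Num.sqrt 0).
  apply: cvgD; first by apply: cvgD => //; exact: cvg_cst.
  apply: cvgM; first exact: cvg_cst.
  apply: cvgM; first exact: cvg_cst.
  exact: (continuous_cvg _ (@sqrt_continuous R 0)).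
rewrite sqrtr0 !mulr0 !addr0 in h.
by apply: (ler_cvg_to vl h); exact: nearW.
Qed.

(** Mean-square convergence implies convergence in mean, which allows passing to the limit in
    integrals over [A]. *)
Lemma ms_limit_integral0 (A : set T) : measurable A ->
  (forall N, S N \in Lfun P 2%:E) ->
  (forall N, (\int[P]_(w in A) (S N w)%:E = 0)%E) ->
  (\int[P]_(w in A) (Z w)%:E = 0)%E.
Proof.
move=> mA S2 S0; have Z2 := ms_limit_Lfun2 S2.
have Pfin : P setT \is a fin_num := fin_num_measure P _ measurableT.
have Z1 := Lfun_subset12 Pfin Z2.
have iA (f : T -> R) : f \in Lfun P 1 -> P.-integrable A (EFin \o f).
  move=> /Lfun1_integrable; exact: integrableS.
apply/eqP; rewrite -abse_eq0 eq_le abse_ge0 andbT.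
apply/lee_addgt0Pr => t t0; rewrite add0e.
have [N hN] := ms_limit_lt (exprn_gt0 2 t0).
have D2 : (S N - Z) \in Lfun P 2%:E by rewrite rpredB ?lee1n.
have D1 := Lfun_subset12 Pfin D2.
have -> : (\int[P]_(w in A) (Z w)%:E =
    - \int[P]_(w in A) ((S N - Z) w)%:E)%E.
  rewrite (_ : (fun w => ((S N - Z) w)%:E) =
    (fun w => (S N w)%:E - (Z w)%:E)%E)//.
  rewrite integralB_EFin//; first by rewrite S0 sub0e oppeK.
    exact: iA (Lfun_subset12 Pfin (S2 N)).
  exact: iA.
rewrite abseN; apply: le_trans (le_abse_integral _ mA _) _.
  exact: measurable_int (iA _ D1).
pose sq w := (S N w - Z w) ^+ 2.
have sq1 : sq \in Lfun P 1.
  by apply/Lfun1_integrable; exact: Lfun2_integrable_sqr D2.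
(* The bound [|x| <= x^2 / (2 t) + t / 2]. A second moment below [t ^+ 2] makes the integral of [g]
   at most [t]. *)
pose g : T -> R := ((2 * t)^-1 \o* sq)%R \+ cst (t / 2).
have gE w : g w = (2 * t)^-1 * sq w + t / 2 by rewrite /g/= mulrC.
have g1 : g \in Lfun P 1 by rewrite rpredD ?Lfun_cst// Lfun_scale.
have ig : P.-integrable setT (EFin \o g) by exact/Lfun1_integrable.
have g0 w : 0 <= g w.
  have t2 : 0 <= (2 * t)^-1 by rewrite invr_ge0; lra.
  by rewrite gE addr_ge0//; [rewrite mulr_ge0// sqr_ge0|lra].
apply: (@le_trans _ _ (\int[P]_(w in setT) (g w)%:E)%E).
  apply: (@le_trans _ _ (\int[P]_(w in A) (g w)%:E)%E); last first.
    apply: ge0_subset_integral => //; first exact: measurable_int ig.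
    by move=> w _; rewrite lee_fin.
  apply: ge0_le_integral => //.
  - by apply: measurableT_comp => //; exact: measurable_int (iA _ D1).
  - exact: measurable_funTS (measurable_int _ ig).
  - move=> w _; rewrite lee_fin gE -subr_ge0.
    rewrite /sq -[X in _ * X](real_normK (num_real _)).
    change ((S N - Z) w) with (S N w - Z w); set x := `|_|.
    rewrite [leRHS](_ : _ = (2 * t)^-1 * (x - t) ^+ 2).
      by rewrite mulr_ge0 ?sqr_ge0// invr_ge0; lra.
    by field; rewrite gt_eqF.
have -> : (\int[P]_w (g w)%:E = ((2 * t)^-1)%:E * 'E_P[sq] + (t / 2)%:E)%E.
  transitivity ('E_P[g])%E; first by rewrite unlock.
  rewrite expectationD ?Lfun_cst ?Lfun_scale// expectationZl//.
  by rewrite expectation_cst.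
apply: (@le_trans _ _ (((2 * t)^-1)%:E * (t ^+ 2)%:E + (t / 2)%:E)%E).
  rewrite leeD2r//; apply: lee_wpmul2l; last exact: ltW.
  by rewrite lee_fin invr_ge0; lra.
rewrite -EFinM -EFinD lee_fin le_eqVlt; apply/orP; left; apply/eqP.
by field; rewrite gt_eqF.
Qed.

End MeanSquare.

(** * Measurable versions and uniqueness of conditional expectations *)

Section ConditionalExpectation.
Context {d : measure_display} {T : measurableType d} {R : realType}.
Variables (P : probability T R) (G : set (set T)).
Hypothesis G_meas : <<s G >> `<=` measurable.

Lemma measurable_fun_sigmaP (f : T -> R) :
  (forall B, measurable B -> <<s G >> (f @^-1` B)) <->
  measurable_fun [set: g_sigma_algebraType G] f.
Proof.
split=> [mf _ B mB|mf B mB]; first by rewrite setTI; exact: mf.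
by rewrite -[_ @^-1` _]setTI; exact: mf.
Qed.

Lemma measurable_fun_sub_sigma (f : T -> R) :
  (forall B, measurable B -> <<s G >> (f @^-1` B)) -> measurable_fun [set: T] f.
Proof. by move=> mf _ B mB; rewrite setTI; exact: (G_meas (mf _ mB)). Qed.

(* A subsequence converges almost surely, and its upper limit is measurable
   with respect to the sub-sigma-algebra. *)
Lemma ms_limit_version (S : nat -> T -> R) (Z : T -> R) :
  (forall N B, measurable B -> <<s G >> (S N @^-1` B)) ->
  measurable_fun setT Z ->
  (fun N => 'E_P[fun w => ((S N w - Z w) ^+ 2)%R])%E @ \oo --> 0%E ->
  exists Z' : T -> R, (forall B, measurable B -> <<s G >> (Z' @^-1` B)) /\
    {ae P, forall w, Z' w = Z w}.
Proof.
move=> GS mZ SZ.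
have mS N : measurable_fun setT (S N).
  by apply: measurable_fun_sub_sigma; exact: GS.
have e0 k : 0 < (1 / (2 ^ (k + 1))%N%:R : R).
  by rewrite divr_gt0// ltr0n expn_gt0.
(* Summable errors along [phi] make the series of squared errors integrable, hence finite almost
   everywhere. *)
have /choice[phi hphi] : forall k, exists N,
    ('E_P[fun w => ((S N w - Z w) ^+ 2)%R] < (1 / (2 ^ (k + 1))%N%:R)%:E)%E.
  by move=> k; exact: ms_limit_lt SZ _ (e0 k).
pose f k w := ((S (phi k) w - Z w) ^+ 2)%:E.
have mf k : measurable_fun setT (f k).
  by apply/measurable_EFinP/measurable_funX/measurable_funB.
have f0 k w : setT w -> (0 <= f k w)%E by move=> _; rewrite lee_fin sqr_ge0.
have sumf : (\int[P]_w (\sum_(k <oo) f k w) < +oo)%E.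
  rewrite integral_nneseries//.
  apply: (@le_lt_trans _ _ (\sum_(k <oo) (1 / (2 ^ (k + 1))%N%:R)%:E)%E).
    apply: lee_nneseries => [k _ _|k _].
      by apply: integral_ge0 => w _; exact: f0.
    by have := ltW (hphi k); rewrite unlock.
  by rewrite (cvg_lim _ (@cvg_geometric_eseries_half R 1 0))// ltry.
have aef : {ae P, forall w, (\sum_(k <oo) f k w < +oo)%E}.
  have sf0 w : (0 <= \sum_(k <oo) f k w)%E.
    by apply: nneseries_ge0 => k _ _; exact: f0.
  have : P.-integrable setT (fun w => \sum_(k <oo) f k w)%E.
    apply/integrableP; split.
      by apply: ge0_emeasurable_sum => // k w _ _; exact: f0.
    rewrite (le_lt_trans _ sumf)// le_eqVlt; apply/orP; left; apply/eqP.
    by apply: eq_integral => w _ /=; rewrite gee0_abs//; exact: sf0.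
  move=> /integrable_ae => /(_ measurableT); apply: filterS => w /(_ I).
  by rewrite ge0_fin_numE.
(* The upper limit is defined at every point, so measurability holds even where the subsequence
   diverges; [fine] sends infinite values to 0. *)
exists (fun w => fine (limn_esup (fun k => (S (phi k) w)%:E))); split.
  apply/measurable_fun_sigmaP.
  apply: (@measurableT_comp _ _ _ _ _ _ (@fine R)) => //.
  apply: measurable_fun_limn_esup => k.
  by apply/measurable_EFinP/measurable_fun_sigmaP => B mB; exact: GS.
apply: filterS aef => w fw.
have cS : (fun k => S (phi k) w) @ \oo --> Z w.
  have c2 : (fun k => (S (phi k) w - Z w) ^+ 2) @ \oo --> (0 : R).
    by apply: cvg_series_cvg_0; apply: nnseries_is_cvg fw => k; exact: sqr_ge0.
  apply/subr_cvg0/norm_cvg0P; rewrite -sqrtr0.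
  rewrite (_ : (fun _ => _) = (fun k => Num.sqrt ((S (phi k) w - Z w) ^+ 2))).
    exact: (continuous_cvg _ (@sqrt_continuous R 0)).
  by apply/funext => k; rewrite sqrtr_sqr.
have cE : (fun k => (S (phi k) w)%:E) @ \oo --> (Z w)%:E.
  by apply: cvg_EFin => //; exact: nearW.
by rewrite is_cvg_limn_esupE; [rewrite (cvg_lim _ cE)|exact: cvgP cE].
Qed.

(** Both versions are viewed on [T] with the smaller sigma-algebra, under the push-forward of [P] by
    the identity. There every measurable set is a test set, and equal integrals force almost sure
    equality. *)
Lemma cond_expectation_unique (X Y Y' : T -> R) :
  is_cond_expectation P <<s G >> X Y -> is_cond_expectation P <<s G >> X Y' ->
  {ae P, forall w, Y w = Y' w}.
Proof.
move=> [GY iY hY] [GY' iY' hY'].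
pose T' : measurableType _ := g_sigma_algebraType G.
pose iota : T -> T' := idfun.
have miota : measurable_fun setT iota.
  by move=> _ B mB; rewrite setTI; exact: G_meas.
pose io : {mfun T >-> T'} :=
  HB.pack iota (isMeasurableFun.Build _ _ _ _ iota miota).
pose Q := distribution P io.
have mY : measurable_fun [set: T'] (EFin \o Y).
  exact/measurable_EFinP/measurable_fun_sigmaP.
have mY' : measurable_fun [set: T'] (EFin \o Y').
  exact/measurable_EFinP/measurable_fun_sigmaP.
have QY : Q.-integrable setT (EFin \o Y) by exact: integrable_pushforward.
have : ae_eq Q setT (EFin \o Y) (EFin \o Y').
  apply: integral_ae_eq => // E _ mE.
  have iE (f : T -> R) : P.-integrable setT (EFin \o f) ->
      P.-integrable (io @^-1` E) (EFin \o f \o io).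
    by move=> h; apply: integrableS h => //; exact: G_meas.
  rewrite !integral_pushforward//; [|exact: iE|exact: iE].
  by rewrite /= (hY E mE) (hY' E mE).
move=> [N [mN QN YN]]; exists N; split => //; first exact: G_meas.
by apply: subset_trans YN => w /= h /(_ I)[].
Qed.

(** Existence of one version rules out the default value of [xget]. *)
Lemma cond_expectationP (X Y : T -> R) : is_cond_expectation P <<s G >> X Y ->
  is_cond_expectation P <<s G >> X (cond_expectation P <<s G >> X).
Proof.
move=> XY; apply: (@xgetPex _ (cst 0)
  [set Y | is_cond_expectation P <<s G >> X Y]).
by exists Y.
Qed.

End ConditionalExpectation.

Lemma variance_ae_eq {d : measure_display} {T : measurableType d} {R : realType}
    (P : probability T R) (X Y : T -> R) :
  measurable_fun setT X -> measurable_fun setT Y ->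
  {ae P, forall w, X w = Y w} -> 'V_P[X] = 'V_P[Y].
Proof.
move=> mX mY XY; have EXY : 'E_P[X]%E = 'E_P[Y]%E.
  rewrite unlock; apply: ae_eq_integral => //; try exact/measurable_EFinP.
  by apply: filterS XY => w XYw _; rewrite XYw.
rewrite /variance unlock EXY unlock; apply: ae_eq_integral => //.
- by apply/measurable_EFinP/measurable_funM; exact: measurable_funB.
- by apply/measurable_EFinP/measurable_funM; exact: measurable_funB.
- by apply: filterS XY => w XYw _; rewrite !fctE /= XYw.
Qed.

(** The integral over [A] is the expectation of [X] times the indicator of [A], and independence
    factors it through the zero mean of [X]. *)
Lemma integral_indep_sigma_eq0 {d : measure_display} {T : measurableType d}
    {R : realType} (P : probability T R) (F G : set (set T)) (X : {RV P >-> R})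
    (A : set T) :
  <<s G >> `<=` measurable -> independent_sigma P F <<s G >> ->
  (forall B, measurable B -> F (X @^-1` B)) ->
  (X : T -> R) \in Lfun P 2%:E -> 'E_P[X]%E = 0%E -> <<s G >> A ->
  (\int[P]_(w in A) (X w)%:E = 0)%E.
Proof.
move=> mG FG FX X2 X0 GA; have mA := mG _ GA.
have mI : measurable_fun setT (\1_A : T -> R) by exact: measurable_indic.
pose I_A : {RV P >-> R} :=
  HB.pack (\1_A : T -> R) (isMeasurableFun.Build _ _ _ _ _ mI).
have I2 : (I_A : T -> R) \in Lfun P 2%:E.
  apply: Lfun2_expectation_sqr => //.
  rewrite (_ : (fun w => _) = \1_A).
    by rewrite expectation_indic// ltey_eq fin_num_measure.
  apply/funext => w; change (\1_A w ^+ 2 = \1_A w :> R).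
  by rewrite indicE -natrX; case: (w \in A).
have : ('E_P[(X : T -> R) * I_A] = 0)%E.
  rewrite expectation_indepM//; first by rewrite X0 mul0e.
  move=> B C mB mC; apply: FG; first exact: FX.
  have GT : <<s G >> setT.
    by have := sigma_algebraC (@sigma_algebra0 _ setT G); rewrite setC0.
  change (<<s G >> ((\1_A : T -> R) @^-1` C)); rewrite preimage_indic.
  case: ifPn => _; case: ifPn => _ //; first exact: sigma_algebraC.
  exact: sigma_algebra0.
rewrite unlock => <-; rewrite integral_mkcond; apply: eq_integral => w _.
rewrite patchE.
change ((if w \in A then (X w)%:E else 0%E) = (X w * \1_A w)%:E).
by rewrite indicE; case: (w \in A); rewrite ?mulr1 ?mulr0.
Qed.

(** * Sigma-algebras generated by a family of variables *)

Section GeneratedSigma.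
Context {d : measure_display} {T : measurableType d} {R : realType}.
Variables (I : Type) (J : set I) (X : I -> T -> R).

Lemma generated_sigma_measurable :
  (forall i, J i -> measurable_fun setT (X i)) ->
  generated_sigma J X `<=` measurable.
Proof.
move=> mX; apply: smallest_sub; first exact: sigma_algebra_measurable.
by move=> A [i Ji [B mB <-]]; exact: mX.
Qed.

Lemma generated_sigma_preimage i (B : set R) : J i -> measurable B ->
  generated_sigma J X (X i @^-1` B).
Proof.
move=> Ji mB; apply: sub_sigma_algebra; exists i => //.
by exists B => //; rewrite setTI.
Qed.
End GeneratedSigma.

(** * Lower bound on the demand-driven order variance *)

Theorem mainTheorem1 (d : measure_display) (T : measurableType d) (R : realType)
  (P : probability T R) (n : nat) (theta_ lambda_ : nat -> R)
  (D : int -> {RV P >-> R}) (eps q IP qhat : nat -> int -> {RV P >-> R})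
  (theta lambda sigmaD : R) (sigma : nat -> R)
  (hbench : linear_benchmark n theta_ lambda_ D eps q IP qhat)
  (hstat : stationary_orders n theta_ lambda_ D eps q)
  (theta_gt0 : 0 < theta) (lambda_gt0 : 0 < lambda) (lambda_le1 : lambda <= 1)
  (htheta : forall k, (1 <= k <= n)%N -> theta <= theta_ k)
  (hlambda : forall k, (1 <= k <= n)%N -> lambda <= lambda_ k <= 1)
  (D_mean : forall t, 'E_P[D t]%E = 0%E)
  (D_indep : mutually_independent P setT (fun t => D t : T -> R))
  (sigmaD_gt0 : 0 < sigmaD ^+ 2)
  (D_var : forall t, ((sigmaD ^+ 2)%:E <= 'V_P[D t])%E)
  (eps_mean : forall k t, (1 <= k <= n)%N -> 'E_P[eps k t]%E = 0%E)
  (eps_indep :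
    mutually_independent P (shock_index n) (fun kt => eps kt.1 kt.2 : T -> R))
  (eps_D_indep : independent_sigma P (shock_sigma n eps) (demand_sigma D))
  (sigma_gt0 : forall k, (1 <= k <= n)%N -> 0 < sigma k ^+ 2)
  (eps_var : forall k t, (1 <= k <= n)%N ->
    ((sigma k ^+ 2)%:E <= 'V_P[eps k t])%E) :
  1 < Gamma_factor theta lambda /\
  forall k t, (1 <= k <= n)%N ->
    ((sigmaD ^+ 2 * Gamma_factor theta lambda ^+ k)%:E
       <= 'V_P[cond_expectation P (demand_sigma D) (q k t)])%E.
Proof.
have l01 : 0 < lambda <= 1 by rewrite lambda_gt0.
split; first exact: Gamma_factor_gt1.
move=> k t kn; have Gam0 : 0 <= Gamma_factor theta lambda.
  by rewrite ltW// (lt_trans ltr01)// Gamma_factor_gt1.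
have Pfin : P setT \is a fin_num := fin_num_measure P _ measurableT.
have [U [W [UP WP qE]]] := hstat k t kn.
have [a [ea sa Ga]] : exists a, [/\
    is_expansion
      (\prod_(1 <= r < k.+1) order_transfer (theta_ r) (lambda_ r)) a,
    sqsummable a & Gamma_factor theta lambda ^+ k <= autocorr a 0].
  apply: (@transfer_product_energy R theta_ lambda_ n) => //.
  - by move=> r rn; rewrite (le_trans (ltW theta_gt0))// htheta.
  - move=> r rn; have /andP[lr ->] := hlambda _ rn.
    by rewrite (lt_le_trans lambda_gt0).
  - by have /andP[] := kn.
  - move=> r rn.
    by apply: Gamma_factor_homo => //; [exact: htheta|exact: hlambda].
rewrite /ms_filter_limit (expansionE ea) in UP.
pose S N w := \sum_(j < N) a j * D (t - j%:Z) w.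
have D2 s : (D s : T -> R) \in Lfun P 2%:E.
  exact: (benchmark_demand_L2 hbench).
have S2 N : S N \in Lfun P 2%:E.
  exact: (Lfun2_lincomb N a (fun j => D2 (t - j%:Z))).
have mD : demand_sigma D `<=` measurable.
  by apply: generated_sigma_measurable => s _; exact: measurable_funP.
have GS N B : measurable B -> demand_sigma D (S N @^-1` B).
  move: B; apply/measurable_fun_sigmaP; apply: measurable_sum => j.
  apply: measurable_funM; first exact: measurable_cst.
  by apply/measurable_fun_sigmaP => B mB; exact: generated_sigma_preimage.
have mS N : measurable_fun setT (S N) by exact: measurable_fun_sub_sigma (GS N).
have mU : measurable_fun setT U by exact: measurable_funP.
have U2 := ms_limit_Lfun2 mS mU UP S2.
(* [U] is fixed only up to a null set and may fail to be measurable for the demand sigma-algebra;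
   [U'] is a version that is. *)
have [U' [GU' U'U]] := ms_limit_version mD GS mU UP.
have mU' := measurable_fun_sub_sigma mD GU'.
have iU : P.-integrable setT (EFin \o U).
  exact/Lfun1_integrable/Lfun_subset12.
have iU' : P.-integrable setT (EFin \o U').
  have miU' : measurable_fun setT (EFin \o U') by exact/measurable_EFinP.
  apply/integrableP; split => //; have /integrableP[miU Uoo] := iU.
  rewrite (ae_eq_integral (fun w => `|(U w)%:E|)%E)//;
    try exact: measurableT_comp.
  by apply: filterS U'U => w U'Uw _ /=; rewrite U'Uw.
(* Each shock has zero integral over a demand event, hence so do the truncated shock series and
   their mean-square limit. *)
have W0 j A : (1 <= j <= k)%N -> demand_sigma D A ->
    P.-integrable A (EFin \o W j) /\ (\int[P]_(w in A) (W j w)%:E = 0)%E.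
  move=> jk DA; have jn : (1 <= j <= n)%N by lia.
  have e2 s : (eps j s : T -> R) \in Lfun P 2%:E.
    by have [] := benchmark_L2 hbench s jn.
  have mA := mD _ DA; have := WP _ jk; rewrite /ms_filter_limit.
  move: (expansion _) => c WjP.
  pose V N w := \sum_(i < N) c i * eps j (t - i%:Z) w.
  have V2 N : V N \in Lfun P 2%:E.
    exact: (Lfun2_lincomb N c (fun i => e2 (t - i%:Z))).
  have mV N : measurable_fun setT (V N).
    by apply: measurable_sum => i; apply: measurable_funM.
  have mW : measurable_fun setT (W j) by exact: measurable_funP.
  have Wj2 := ms_limit_Lfun2 mV mW WjP V2.
  split.
    apply: (integrableS measurableT) => //.
    exact/Lfun1_integrable/Lfun_subset12.
  apply: (ms_limit_integral0 mV mW WjP mA V2) => N.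
  have ie s : P.-integrable A (EFin \o eps j s).
    apply: (integrableS measurableT) => //.
    exact/Lfun1_integrable/Lfun_subset12.
  have ice i : P.-integrable A (fun w => (c i)%:E * (eps j (t - i%:Z) w)%:E)%E.
    by apply: integrableZl => //; exact: ie.
  under eq_integral => w _ do rewrite /V -sumEFin.
  rewrite (integral_sum mA (fun i : 'I_N => ice i)) big1// => i _.
  rewrite (integralZl mA (ie _)) (integral_indep_sigma_eq0 mD eps_D_indep)//.
  - by rewrite mule0.
  - move=> B mB; apply: (generated_sigma_preimage (i := (j, t - i%:Z))) => //.
  - exact: eps_mean.
(* Over a demand event only the demand series contributes to the integral of the order. *)
have condU' : is_cond_expectation P (demand_sigma D) (q k t) U'.
  split=> // A DA; have mA := mD _ DA.
  have iAU : P.-integrable A (EFin \o U) by exact: integrableS iU.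
  have [iW W00] :
      P.-integrable A (EFin \o (fun w => \sum_(1 <= j < k.+1) W j w))
      /\ (\int[P]_(w in A) (\sum_(1 <= j < k.+1) W j w)%:E = 0)%E.
    have : forall m, (m <= k)%N ->
        P.-integrable A (EFin \o (fun w => \sum_(1 <= j < m.+1) W j w)) /\
        (\int[P]_(w in A) (\sum_(1 <= j < m.+1) W j w)%:E = 0)%E.
      elim=> [_|m IH mk].
        under eq_fun do rewrite big_nil.
        split; first exact: integrable0.
        by apply: integral0_eq => w _; rewrite big_nil.
      have [i1 i10] := IH (ltnW mk).
      have [i2 i20] : P.-integrable A (EFin \o W m.+1) /\
        (\int[P]_(w in A) (W m.+1 w)%:E = 0)%E by exact: W0.
      split.
        under eq_fun do rewrite big_nat_recr//=.
        exact: (integrableD mA i1 i2).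
      under eq_integral => w _ do rewrite big_nat_recr//= EFinD.
      by rewrite (integralD_EFin mA i1 i2) i10 i20 adde0.
    by apply.
  transitivity (\int[P]_(w in A) (U w)%:E)%E.
    apply: ae_eq_integral => //.
    - by apply/measurable_EFinP; exact: measurable_funTS.
    - by apply/measurable_EFinP; exact: measurable_funTS.
    - by apply: filterS U'U => w U'Uw _; rewrite U'Uw.
  under [RHS]eq_integral => w _ do rewrite qE EFinD.
  by rewrite integralD_EFin// W00 adde0.
have condY := cond_expectationP condU'.
have YU' := cond_expectation_unique mD condY condU'.
have mY : measurable_fun setT (cond_expectation P (demand_sigma D) (q k t)).
  by case: condY => GY _ _; apply: (measurable_fun_sub_sigma mD); exact: GY.
(* The variance of the chosen version equals that of [U], which is bounded through its
   truncations. *)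
rewrite (variance_ae_eq mY mU' YU') (variance_ae_eq mU' mU U'U).
apply: (@le_trans _ _ (sigmaD ^+ 2 * autocorr a 0)%:E).
  by rewrite lee_fin ler_wpM2l// sqr_ge0.
(* Demands at distinct times are uncorrelated, so the truncation has variance at least [v N], whose
   limit is [sigmaD ^+ 2] times the filter's energy. *)
pose v N := sigmaD ^+ 2 * series (fun j => a j * a (j + 0)%N) N.
have vl : v @ \oo --> sigmaD ^+ 2 * autocorr a 0.
  by apply: cvgM; [exact: cvg_cst|exact: autocorr_cvg].
apply: ms_limit_variance vl => // N.
rewrite (variance_sum_uncorrelated N a (X := fun j => D (t - j%:Z)))//.
  rewrite /v /series/= big_mkord mulr_sumr -sumEFin lee_sum// => j _.
  rewrite addn0 -expr2 mulrC EFinM.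
  by apply: lee_wpmul2l => //; rewrite lee_fin sqr_ge0.
move=> i j ij; apply: covariance_indep => // A B mA mB.
by apply: (mutually_independent_pair D_indep) => //; lia.
Qed.
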